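(* Let $n\ge 1$, let $X_1,\dots,X_n$ be independent random variables with a common continuous distribution function $F$, and let $\Pi(n)$ be the set of feasible policies for the sequential selection of a unimodal subsequence of $X_1,\dots,X_n$. For the unique optimal policy $\pi^*_n\in\Pi(n)$, i.e. the policy attaining $\sup_{\pi_n\in\Pi(n)}\mathbb{E}[U^o_n(\pi_n)]$, one has $$\mathrm{Var}[U^o_n(\pi^*_n)] \leq \mathbb{E}[U^o_n(\pi^*_n)] < 2n^{1/2}.$$
   Context: Let $\mathcal{F}_i=\sigma\{X_1,\dots,X_i\}$, $1\le i\le n$. The variables $X_1,\dots,X_n$ are presented one at a time; when $X_i$ is presented at time $i$ the chooser must irrevocably accept or reject it, using only $X_1,\dots,X_i$. A policy thus yields indices $1\le \tau_1<\tau_2<\cdots<\tau_k\le n$ of selected elements, each $\tau_j$ being a stopping time with respect to $(\mathcal{F}_i)$. A policy is feasible (belongs to $\Pi(n)$) if the selected values are always unimodal, meaning that for some $1\le t\le k$ $$X_{\tau_1}\le\cdots\le X_{\tau_t}\ge X_{\tau_{t+1}}\ge\cdots\ge X_{\tau_k}$$ (increasing piece first, then decreasing piece; either piece may have size one). $U^o_n(\pi_n)$ is the number $k$ of elements selected by $\pi_n$. An optimal policy exists and is unique in the sense that any two optimal policies almost surely select the same elements, so the distribution of $U^o_n(\pi_n^* )$ is well defined. *)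

(* Defs.v *)
From mathcomp Require Import all_boot all_order all_algebra.
From mathcomp Require Import all_classical all_reals all_analysis.

Set Implicit Arguments.
Unset Strict Implicit.
Unset Printing Implicit Defensive.

Import Order.TTheory GRing.Theory Num.Theory.
Import numFieldNormedType.Exports.

Local Open Scope classical_set_scope.
Local Open Scope ring_scope.

(* The library has no notion of independence for families of random
   variables. *)
Definition mutually_independent (d : measure_display) (T : measurableType d)
    (R : realType) (P : probability T R) (n : nat)
    (X : 'I_n -> {RV P >-> R}) : Prop :=
  forall (J : {set 'I_n}) (B : 'I_n -> set R),
    (forall i, i \in J -> measurable (B i)) ->
    P (\bigcap_(i in [set i | i \in J]) (X i @^-1` B i)) =
    (\prod_(i in J) P (X i @^-1` B i))%E.

(* Observations are numbered from 0: the sigma-algebra at time i is generated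
   by X_0, ..., X_i. *)
Definition past (T : Type) (R : realType) (n : nat) (X : 'I_n -> T -> R)
    (i : 'I_n) : set (set T) :=
  g_sigma_preimage (fun j : 'I_i.+1 => X (widen_ord (ltn_ord i) j)).

(* [pi i w] is the decision to accept the i-th observation in the outcome w.
   For an adapted policy the j-th selection time is a stopping time, the event
   that it equals i being that i is accepted and exactly j - 1 of the previous
   observations are. *)
Definition policy (T : Type) (n : nat) := 'I_n -> T -> bool.

Definition adapted (T : Type) (R : realType) (n : nat) (X : 'I_n -> T -> R)
    (pi : policy T n) : Prop :=
  forall i, past X i [set w | pi i w].

(* [enum 'I_n] is increasing, so the selection times are listed in order. *)
Definition selected (T : Type) (n : nat) (pi : policy T n) (w : T) :
    seq 'I_n :=
  [seq i <- enum 'I_n | pi i w].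

Definition U (T : Type) (R : realType) (n : nat) (pi : policy T n) (w : T) :
    R :=
  (size (selected pi w))%:R.

(* The t-th entry, the mode, belongs to both the nondecreasing prefix
   [take t s] and the nonincreasing suffix [drop t.-1 s]. *)
Definition unimodal (R : realType) (s : seq R) : Prop :=
  exists t : nat, [/\ (1 <= t <= size s)%N,
    sorted (fun x y => x <= y) (take t s) &
    sorted (fun x y => y <= x) (drop t.-1 s)].

Definition feasible (T : Type) (R : realType) (n : nat) (X : 'I_n -> T -> R)
    (pi : policy T n) : Prop :=
  adapted X pi /\
  forall w, unimodal [seq X i w | i <- selected pi w].

Definition optimal (d : measure_display) (T : measurableType d)
    (R : realType) (P : probability T R) (n : nat)
    (X : 'I_n -> {RV P >-> R}) (pi : policy T n) : Prop :=
  feasible (fun i => X i) pi /\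
  'E_P[U R pi]%E =
    ereal_sup [set 'E_P[U R pi']%E | pi' in [set pi' | feasible (fun i => X i) pi']].

(* Main.v *)
(**
The pair (last accepted value, still increasing or not) makes the problem a
Markov decision problem with independent observations, whose value [V_k] with
[k] observations left solves the Bellman equation
  [V_(k+1) s = E (max (V_k s) (1 + V_k (step s Y)))],
the maximum being [V_k s] when [Y] is not admissible in the state [s].  Along
any feasible policy, [M_i], the number of values accepted so far plus [V_(n-i)]
at the current state, has a nonincreasing mean, and the greedy policy for [V]
keeps it constant.  Hence an optimal policy has mean [V_n s0] and almost surely
attains the maximum at each step.

Variance.  Accepting a value can only restrict the future, so the maximum
exceeds [V_k s] by an amount [g] in [0, 1].  As [g ^ 2 <= g], the conditional
variance of an increment of [M] is at most the mean [V_(k+1) s - V_k s] of [g],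
and these means add up to at most [V_n s0].

Mean.  For every [l > 0], [V_k s <= k * l / 2 + v s / l], where [v s] bounds the
variation of [F] along the values still to be accepted, so that [v s0 = 2].
Indeed, for an admissible set [A] of probability [p], the mean over [A] of the
variation spent is at least [p ^ 2 / 2], and [p - p ^ 2 / (2 * l) <= l / 2].
Since [V_1 <= min 1 v], the bound has a uniform positive gap at [k = 1], which
persists; then take [l = 2 / sqrt n].
*)

Require Import Defs.
From mathcomp Require Import all_boot all_order all_algebra.
From mathcomp Require Import all_classical all_reals all_analysis.
From mathcomp Require Import measurable_realfun ring lra.

Set Implicit Arguments.
Unset Strict Implicit.
Unset Printing Implicit Defensive.

Import Order.TTheory GRing.Theory Num.Theory.
Import numFieldNormedType.Exports.

Local Open Scope classical_set_scope.
Local Open Scope ring_scope.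

(** * Integrals of bounded functions *)

Section bounded_integrals.
Context d (T : measurableType d) (R : realType) (P : probability T R).
Implicit Types (f g : T -> R) (C : R).

Lemma bounded_integrable f C : measurable_fun setT f ->
  (forall x, `|f x| <= C) -> P.-integrable setT (EFin \o f).
Proof.
move=> mf fC; apply: measurable_bounded_integrable => //.
  by rewrite (le_lt_trans (probability_le1 P measurableT))// ltry.
exists C; split; first exact: num_real.
by move=> M CM x _; apply: le_trans (fC x) _; exact: ltW.
Qed.

Lemma Rintegral_probability_cst (r : R) : \int[P]_x r = r.
Proof. by rewrite Rintegral_cst//= [P setT]probability_setT mulr1. Qed.

Lemma integral_EFin_Rintegral f : P.-integrable setT (EFin \o f) ->
  (\int[P]_x (f x)%:E)%E = (\int[P]_x f x)%:E.
Proof. by move=> fi; rewrite fineK// integrable_fin_num. Qed.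

End bounded_integrals.

(** * Integrating out an independent variable *)

Section independent_integral.
Context d (T : measurableType d) (R : realType) (P : probability T R).
Context dD (D : measurableType dD).
Variables (Z : T -> D) (Y : {RV P >-> R}).
Hypothesis mZ : measurable_fun setT Z.
Hypothesis ZY : forall A B, measurable A -> measurable B ->
  P (Z @^-1` A `&` Y @^-1` B) = (P (Z @^-1` A) * P (Y @^-1` B))%E.

Let mfunZ : {mfun T >-> D} := mfun_Sub (mem_set mZ).
Let ZYf : T -> D * R := fun w => (Z w, Y w).
Let mZY : measurable_fun setT ZYf.
Proof. exact: measurable_fun_pair. Qed.
Let mfunZY : {mfun T >-> (D * R)%type} := mfun_Sub (mem_set mZY).

Lemma independent_joint_law (X : set (D * R)) : measurable X ->
  (distribution P mfunZ \x distribution P Y)%E X = distribution P mfunZY X.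
Proof.
apply: product_measure_unique => A B mA mB.
by rewrite /distribution /pushforward/= -ZY.
Qed.

Lemma ge0_independent_integral (h : D * R -> R) :
  measurable_fun setT h -> (forall z, 0 <= h z) ->
  (\int[P]_w (h (Z w, Y w))%:E)%E =
  (\int[P]_w (\int[distribution P Y]_y (h (Z w, y))%:E))%E.
Proof.
move=> mh h0.
have mEh : measurable_fun setT (EFin \o h) by exact/measurable_EFinP.
transitivity (\int[distribution P mfunZY]_z (h z)%:E)%E.
  by rewrite ge0_integral_distribution// => z; rewrite lee_fin.
transitivity
    (\int[(distribution P mfunZ \x distribution P Y)%E]_z (h z)%:E)%E.
  by apply/esym/eq_measure_integral => A mA _; exact: independent_joint_law.
rewrite (fubini_tonelli1 (EFin \o h))//.
rewrite ge0_integral_distribution//.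
- exact: (measurable_fun_fubini_tonelli_F (EFin \o h)).
- by move=> x; apply: integral_ge0 => y _; rewrite lee_fin.
Qed.

Lemma independent_Rintegral (h : D * R -> R) (C : R) :
  measurable_fun setT h -> (forall w y, 0 <= h (Z w, y) <= C) ->
  \int[P]_w h (Z w, Y w) = \int[P]_w \int[distribution P Y]_y h (Z w, y).
Proof.
(* [h] is known to be nonnegative only at the values of [Z]; its positive part is so everywhere, as
   Tonelli requires, and agrees with [h] there. *)
move=> mh h0C; pose g z := Num.max 0 (h z).
have gE w y : g (Z w, y) = h (Z w, y).
  by rewrite /g max_r//; have /andP[] := h0C w y.
have mg : measurable_fun setT g by exact: measurable_maxr.
transitivity (\int[P]_w g (Z w, Y w)); first by apply: eq_Rintegral => w _.
rewrite {1}/Rintegral ge0_independent_integral//; last first.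
  by move=> z; rewrite /g le_max lexx.
congr fine; apply: eq_integral => w _.
under eq_integral do rewrite gE.
rewrite integral_EFin_Rintegral//; apply: (@bounded_integrable _ _ _ _ _ C).
  have -> : (fun y => h (Z w, y)) = (fun y => g (Z w, y)) by apply/funext.
  by apply: measurableT_comp mg _; exact: pair1_measurable.
by move=> y; have /andP[h0 hC] := h0C w y; rewrite ger0_norm.
Qed.

End independent_integral.

(** * Bellman value functions *)

Section decision_problem.
Context (R : realType) dS (S : measurableType dS).
Variables (adm : S * R -> bool) (step : S * R -> S).
Hypothesis madm : measurable_fun setT adm.
Hypothesis mstep : measurable_fun setT step.

(** The whole Bellman maximum, rejection included; what the observation adds is
    [gain V z - V z.1]. *)
Definition gain (V : S -> R) (z : S * R) : R :=
  if adm z then Num.max (V z.1) (1 + V (step z)) else V z.1.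

Lemma measurable_gain V :
  measurable_fun setT V -> measurable_fun setT (gain V).
Proof.
move=> mV; have mV1 : measurable_fun setT (fun z : S * R => V z.1).
  exact: measurableT_comp.
apply: measurable_fun_ifT => //; apply: measurable_maxr => //.
by apply: measurable_funD => //; exact: measurableT_comp.
Qed.

Lemma gain_bounds V (C : R) : (forall s, 0 <= V s <= C) ->
  forall z, 0 <= gain V z <= C + 1.
Proof.
move=> V0C z; have := V0C z.1; have := V0C (step z).
rewrite /gain => /andP[? ?] /andP[? ?].
by case: ifP => _; [case: (leP (V z.1)) => ?|]; lra.
Qed.

Variable mu : nat -> probability R R.

(* [mu k] is the law of the observation after which [k] others remain. *)
Fixpoint value (k : nat) : S -> R :=
  if k is k'.+1 then fun s => \int[mu k']_y gain (value k') (s, y)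
  else cst 0.

Lemma valueS k s :
  value k.+1 s = \int[mu k]_y gain (value k) (s, y).
Proof. by []. Qed.

(** One induction carries both facts: measurability and bounds of [value k] together make the next
    integral meaningful. *)
Lemma value_bounds_measurable k :
  measurable_fun setT (value k) /\ forall s, 0 <= value k s <= k%:R.
Proof.
elim: k => [|k [mV V0k]]; first by split => //= s; rewrite lexx.
have mg := measurable_gain mV; have gb := gain_bounds V0k.
have mgs s : measurable_fun setT (fun y => gain (value k) (s, y)).
  by apply: measurableT_comp mg _; exact: pair1_measurable.
have gi s : (mu k).-integrable setT (EFin \o fun y => gain (value k) (s, y)).
  apply: (@bounded_integrable _ _ _ _ _ (k%:R + 1)) => // y.
  by have /andP[? ?] := gb (s, y); rewrite ger0_norm.
split => [|s] /=.
  have mE : measurable_fun setT (fun s =>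
      (\int[mu k]_y (gain (value k) (s, y))%:E)%E).
    apply: (measurable_fun_fubini_tonelli_F (EFin \o gain (value k))) => //.
    - exact/measurable_EFinP.
    - by move=> z; rewrite lee_fin; have /andP[] := gb z.
  exact: measurableT_comp mE.
apply/andP; split.
  by apply: Rintegral_ge0 => y _; have /andP[] := gb (s, y).
rewrite -(@Rintegral_probability_cst _ _ _ (mu k) k.+1%:R) -natr1.
apply: le_Rintegral => //; last by move=> y _; have /andP[] := gb (s, y).
by apply: (@bounded_integrable _ _ _ _ _ `|k%:R + 1|).
Qed.

Lemma measurable_value k : measurable_fun setT (value k).
Proof. by case: (value_bounds_measurable k). Qed.

Lemma value_ge0 k s : 0 <= value k s.
Proof. by case: (value_bounds_measurable k) => _ /(_ s)/andP[]. Qed.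

Lemma value_le k s : value k s <= k%:R.
Proof. by case: (value_bounds_measurable k) => _ /(_ s)/andP[]. Qed.

Lemma gain_value_bounds k z : 0 <= gain (value k) z <= k%:R + 1.
Proof. by apply: gain_bounds => s; rewrite value_ge0 value_le. Qed.

Lemma gain_value_integrable k s (m : probability R R) :
  m.-integrable setT (EFin \o fun y => gain (value k) (s, y)).
Proof.
apply: (@bounded_integrable _ _ _ _ _ (k%:R + 1)) => [|y].
  by apply: measurableT_comp (measurable_gain (measurable_value k)) _;
     exact: pair1_measurable.
by have /andP[? ?] := gain_value_bounds k (s, y); rewrite ger0_norm.
Qed.

(* [le_state s t] should mean that every sequence admissible from [s] is
   admissible from [t]. *)
(* [le_state s t] should mean that every sequence admissible from [s] is
   admissible from [t]. *)
Variable le_state : S -> S -> Prop.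
Hypothesis le_state_sim : forall s t, le_state s t -> forall y, adm (s, y) ->
  adm (t, y) /\ le_state (step (s, y)) (step (t, y)).
Hypothesis step_le : forall s y, adm (s, y) -> le_state (step (s, y)) s.

(** By simulation, whatever can be accepted from [s] can be accepted from [t] with the states still
    ordered, so the integrands compare pointwise. *)
Lemma value_le_state k s t : le_state s t -> value k s <= value k t.
Proof.
elim: k s t => [//|k IHk] s t st /=.
apply: le_Rintegral => //; [exact: gain_value_integrable..|] => y _.
rewrite /gain; case: ifPn => [/(le_state_sim st)[-> /IHk st']|_] /=.
  by rewrite ge_max !le_max IHk//= lerD2l st' orbT.
by case: ifP => _; rewrite ?le_max IHk.
Qed.

Lemma gain_increment k s y :
  0 <= gain (value k) (s, y) - value k s <= 1.
Proof.
rewrite /gain; case: ifPn => [/step_le/(value_le_state k) ?|_] /=; last lra.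
by case: (leP (value k s)) => ?; lra.
Qed.

(** Put [a = x + value k s] and let [g] be the increment. As [g ^ 2 <= g], the integrand is at most
    [a ^ 2 + (2 * a + 1) * g], which is [f]. Its mean is [(a + e) ^ 2 + e - e ^ 2], where [e] is the
    mean of [g]. *)
Lemma value_second_moment k s (x : R) :
  \int[mu k]_y (x + gain (value k) (s, y)) ^+ 2 <=
  (x + value k.+1 s) ^+ 2 + value k.+1 s - value k s.
Proof.
have gi := gain_value_integrable k s (mu k).
pose v := value k s; set a := x + v.
pose f y := (2 * a + 1) * gain (value k) (s, y) + (a ^+ 2 - (2 * a + 1) * v).
have ci (r : R) : (mu k).-integrable setT (EFin \o fun=> r).
  by apply: (@bounded_integrable _ _ _ _ _ `|r|).
have fi0 : (mu k).-integrable setT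
    (EFin \o fun y => (2 * a + 1) * gain (value k) (s, y)).
  by have := integrableZl measurableT (2 * a + 1) gi.
have fi : (mu k).-integrable setT (EFin \o f).
  by have := integrableD measurableT fi0 (ci (a ^+ 2 - (2 * a + 1) * v)).
have fE : \int[mu k]_y f y =
    (2 * a + 1) * value k.+1 s + (a ^+ 2 - (2 * a + 1) * v).
  by rewrite RintegralD// RintegralZl// Rintegral_probability_cst.
apply: (@le_trans _ _ (\int[mu k]_y f y)).
  apply: le_Rintegral => //.
    apply: (@bounded_integrable _ _ _ _ _ ((`|x| + (k%:R + 1)) ^+ 2)) => [|y].
      apply: measurable_funX; apply: measurable_funD => //.
      by apply: measurableT_comp (measurable_gain (measurable_value k)) _;
        exact: pair1_measurable.
    have /andP[g0 gk] := gain_value_bounds k (s, y).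
    have := ler_normD x (gain (value k) (s, y)); rewrite (ger0_norm g0) => xg.
    by rewrite normrX lerXn2r ?nnegrE ?addr_ge0//; lra.
  move=> y _; have := gain_increment k s y; rewrite /f /a /v.
  set g := gain _ _; set w := value k s => gw.
  have : (g - w) * (g - w) <= g - w by nra.
  nra.
rewrite fE -subr_ge0 /a /v.
rewrite (_ : _ - _ = (value k.+1 s - value k s) ^+ 2) ?sqr_ge0//; ring.
Qed.

End decision_problem.

(** * Adapted policies *)

Section history.
Context d (T : measurableType d) (R : realType) (Y : nat -> {mfun T >-> R}).

Definition history_events (i : nat) : set (set T) :=
  \big[setU/set0]_(j < i) preimage_set_system setT (Y j) measurable.

Lemma history_eventsE i : history_events i =
  \bigcup_(j in `I_i) preimage_set_system setT (Y j) measurable.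
Proof.
exact/esym/(bigcup_mkord _ (fun j => preimage_set_system setT (Y j) _)).
Qed.

(** Time [i] itself is excluded: an adapted decision on [Y i] is measurable for [history i.+1]. *)
Definition history (i : nat) : set (set T) := <<s history_events i >>.

(** [T] equipped with the past as its sigma-algebra, so that adaptedness becomes ordinary
    measurability. *)
Definition history_type (i : nat) := g_sigma_algebraType (history_events i).

Lemma history_preimage i j (B : set R) : (j < i)%N -> measurable B ->
  history i (Y j @^-1` B).
Proof.
move=> ji mB; apply: sub_sigma_algebra.
rewrite history_eventsE; exists j => //=.
by exists B => //; rewrite setTI.
Qed.

Lemma history_measurable i : history i `<=` measurable.
Proof.
apply: smallest_sub; first exact: sigma_algebra_measurable.
rewrite history_eventsE; apply: bigcup_sub => j _ _ [B mB <-].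
exact: measurable_funP.
Qed.

Lemma historyS i : history i `<=` history i.+1.
Proof.
apply: sub_smallest2r; first exact: smallest_sigma_algebra.
by rewrite /history_events big_ord_recr /=; exact: subsetUl.
Qed.

End history.

(** * Runs of a policy and their prospects *)

Section process.
Context (R : realType) dS (S : measurableType dS).
Variables (adm : S * R -> bool) (step : S * R -> S).
Hypothesis madm : measurable_fun setT adm.
Hypothesis mstep : measurable_fun setT step.
Variable le_state : S -> S -> Prop.
Hypothesis le_state_sim : forall s t, le_state s t -> forall y, adm (s, y) ->
  adm (t, y) /\ le_state (step (s, y)) (step (t, y)).
Hypothesis step_le : forall s y, adm (s, y) -> le_state (step (s, y)) s.

Context d (T : measurableType d) (P : probability T R).
Variables (Y : nat -> {RV P >-> R}) (N : nat) (s0 : S).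
Hypothesis Y_history : forall i, (i < N)%N -> forall A B,
  history Y i A -> measurable B ->
  P (A `&` Y i @^-1` B) = (P A * P (Y i @^-1` B))%E.

Implicit Type q : nat -> T -> bool.

(** Acceptances so far and current state, just before [Y i] is observed. *)
Fixpoint run q (i : nat) (w : T) : R * S :=
  if i is j.+1 then
    if q j w then ((run q j w).1 + 1, step ((run q j w).2, Y j w))
    else run q j w
  else (0, s0).

Definition admissible_policy q := forall i, (i < N)%N ->
  history Y i.+1 [set w | q i w] /\
  forall w, q i w -> adm ((run q i w).2, Y i w).

Lemma run1_bounds q i w : 0 <= (run q i w).1 <= i%:R.
Proof.
elim: i => [|i IHi] /=; first by rewrite lexx.
by rewrite -natr1; case: ifP => _ /=; lra.
Qed.

Lemma run_history q i :
  (forall j, (j < i)%N -> history Y j.+1 [set w | q j w]) ->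
  measurable_fun [set: history_type Y i] (run q i).
Proof.
elim: i => [|i IHi] qi; first exact: measurable_cst.
have {IHi} mrun : measurable_fun [set: history_type Y i.+1] (run q i).
  move=> _ A mA; rewrite setTI; apply: historyS.
  have := IHi (fun j ji => qi j (ltnW ji)) measurableT _ mA.
  by rewrite setTI.
apply: measurable_fun_ifT => //.
- apply: (measurable_fun_bool true); rewrite setTI; exact: qi.
- apply: measurable_fun_pair.
    by apply: measurable_funD => //; exact: measurableT_comp.
  apply: measurableT_comp => //; apply: measurable_fun_pair.
    exact: measurableT_comp.
  by move=> _ A mA; rewrite setTI; exact: history_preimage.
Qed.

(** [value] counts the observations still to come, hence the reversed index. For [k >= N] truncated
    subtraction gives the law of [Y 0]. *)
Definition law (k : nat) : probability R R := distribution P (Y (N - k.+1)).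

Local Notation V := (value adm step law).

(** The process [M_i], whose mean no admissible policy can increase. *)
Definition prospect q i w : R := (run q i w).1 + V (N - i) (run q i w).2.

Definition prospect_after i (z : (R * S) * R) : R :=
  z.1.1 + gain adm step (V (N - i.+1)) (z.1.2, z.2).

(** The prospect at time [i.+1] if the decision on [Y i] attains the Bellman maximum. *)
Definition best_prospect q i w : R := prospect_after i (run q i w, Y i w).

Lemma measurable_prospect_after i : measurable_fun setT (prospect_after i).
Proof.
apply: measurable_funD; first exact: measurableT_comp.
apply: measurableT_comp.
  exact: measurable_gain (measurable_value _ _ _ _).
by apply: measurable_fun_pair => //; exact: measurableT_comp.
Qed.

Section policy.
Variable q : nat -> T -> bool.
Hypothesis qP : admissible_policy q.

Lemma measurable_run i : (i <= N)%N -> measurable_fun setT (run q i).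
Proof.
move=> iN _ A mA; apply: history_measurable.
have := @run_history q i _ measurableT _ mA.
by apply=> j ji; have [] := qP (leq_trans ji iN).
Qed.

Lemma run_independent i : (i < N)%N -> forall A B,
  measurable A -> measurable B ->
  P (run q i @^-1` A `&` Y i @^-1` B) =
  (P (run q i @^-1` A) * P (Y i @^-1` B))%E.
Proof.
move=> iN A B mA mB; apply: Y_history => //.
have := @run_history q i _ measurableT _ mA; rewrite setTI; apply=> j ji.
by have [] := qP (ltn_trans ji iN).
Qed.

(** This stands in for conditioning on the past: the run is independent of [Y i], which is
    integrated out with the run frozen. *)
Lemma run_integral i (h : (R * S) * R -> R) (C : R) : (i < N)%N ->
  measurable_fun setT h -> (forall w y, 0 <= h (run q i w, y) <= C) ->
  \int[P]_w h (run q i w, Y i w) =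
  \int[P]_w \int[law (N - i.+1)]_y h (run q i w, y).
Proof.
move=> iN mh hC.
have -> : law (N - i.+1) = distribution P (Y i).
  by rewrite /law subnSK// subKn// ltnW.
apply: independent_Rintegral hC => //; first exact: measurable_run (ltnW iN).
exact: run_independent.
Qed.

Lemma measurable_prospect i : (i <= N)%N ->
  measurable_fun setT (prospect q i).
Proof.
move=> iN; apply: measurable_funD.
  by apply: measurableT_comp (measurable_run iN).
apply: measurableT_comp (measurable_value madm mstep _ _) _.
by apply: measurableT_comp (measurable_run iN).
Qed.

Lemma measurable_best_prospect i : (i < N)%N ->
  measurable_fun setT (best_prospect q i).
Proof.
move=> iN.
apply: (measurableT_comp (measurable_prospect_after i)
  (g := fun w => (run q i w, Y i w))).
by apply: measurable_fun_pair => //; exact: measurable_run (ltnW iN).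
Qed.

Lemma prospect_bounds i w : (i <= N)%N -> 0 <= prospect q i w <= N%:R.
Proof.
move=> iN; have := run1_bounds q i w.
have := value_ge0 madm mstep law (N - i) (run q i w).2.
have := value_le madm mstep law (N - i) (run q i w).2.
by rewrite natrB// /prospect; lra.
Qed.

Lemma prospect_after_bounds i w y : (i < N)%N ->
  0 <= prospect_after i (run q i w, y) <= N%:R.
Proof.
move=> iN; have := run1_bounds q i w.
have := gain_value_bounds madm mstep law (N - i.+1) ((run q i w).2, y).
by rewrite natrB// -natr1 /prospect_after/=; lra.
Qed.

Lemma best_prospect_bounds i w : (i < N)%N ->
  0 <= best_prospect q i w <= N%:R.
Proof. exact: prospect_after_bounds. Qed.

Lemma prospect_integrable i : (i <= N)%N ->
  P.-integrable setT (EFin \o prospect q i).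
Proof.
move=> iN; apply: (@bounded_integrable _ _ _ _ _ N%:R).
  exact: measurable_prospect.
by move=> w; have /andP[? ?] := prospect_bounds w iN; rewrite ger0_norm.
Qed.

Lemma best_prospect_integrable i : (i < N)%N ->
  P.-integrable setT (EFin \o best_prospect q i).
Proof.
move=> iN; apply: (@bounded_integrable _ _ _ _ _ N%:R).
  exact: measurable_best_prospect.
by move=> w; have /andP[? ?] := best_prospect_bounds w iN; rewrite ger0_norm.
Qed.

Lemma prospect_step i w : (i < N)%N -> prospect q i.+1 w <= best_prospect q i w.
Proof.
move=> iN; rewrite /prospect /best_prospect /prospect_after /= /gain.
case: ifP => [qiw|_] /=.
  have [_ /(_ _ qiw) ->] := qP iN.
  by rewrite -addrA lerD2l le_max lexx orbT.
by rewrite lerD2l; case: ifP => // _; rewrite le_max lexx.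
Qed.

(** Integrating out [Y i] turns the gain into [V (N - i)], by the Bellman equation. *)
Lemma best_prospect_mean i : (i < N)%N ->
  \int[P]_w best_prospect q i w = \int[P]_w prospect q i w.
Proof.
move=> iN.
rewrite (run_integral iN (measurable_prospect_after i) (C := N%:R)); last first.
  by move=> w y; exact: prospect_after_bounds.
apply: eq_Rintegral => w _; rewrite /prospect_after /prospect /=.
rewrite RintegralD ?Rintegral_probability_cst//.
- by rewrite -(subnSK iN).
- by apply: (@bounded_integrable _ _ _ _ _ `|(run q i w).1|).
- exact: gain_value_integrable.
Qed.

Lemma prospect_decreasing i : (i < N)%N ->
  \int[P]_w prospect q i.+1 w <= \int[P]_w prospect q i w.
Proof.
move=> iN; rewrite -(best_prospect_mean iN); apply: le_Rintegral => //.
- exact: prospect_integrable.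
- exact: best_prospect_integrable.
- by move=> w _; exact: prospect_step.
Qed.

Lemma prospect_init : \int[P]_w prospect q 0 w = V N s0.
Proof.
by rewrite /prospect/= subn0; under eq_Rintegral do rewrite add0r;
  rewrite Rintegral_probability_cst.
Qed.

Lemma prospect_final w : prospect q N w = (run q N w).1.
Proof. by rewrite /prospect subnn/= addr0. Qed.

Lemma count_mean_le : \int[P]_w (run q N w).1 <= V N s0.
Proof.
under eq_Rintegral do rewrite -prospect_final.
rewrite -prospect_init.
suff H i : (i <= N)%N -> \int[P]_w prospect q i w <= \int[P]_w prospect q 0 w.
  exact: H.
elim: i => [//|i IHi] iN; apply: le_trans (IHi (ltnW iN)).
exact: prospect_decreasing.
Qed.

Lemma count_mean_eq :
  (forall i w, (i < N)%N -> prospect q i.+1 w = best_prospect q i w) ->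
  \int[P]_w (run q N w).1 = V N s0.
Proof.
move=> qE; under eq_Rintegral do rewrite -prospect_final.
rewrite -prospect_init.
suff H i : (i <= N)%N -> \int[P]_w prospect q i w = \int[P]_w prospect q 0 w.
  exact: H.
elim: i => [//|i IHi] iN; rewrite -(IHi (ltnW iN)) -(best_prospect_mean iN).
by apply: eq_Rintegral => w _; exact: qE.
Qed.

Lemma run_value_integrable i k : (i <= N)%N ->
  P.-integrable setT (EFin \o fun w => V k (run q i w).2).
Proof.
move=> iN; apply: (@bounded_integrable _ _ _ _ _ k%:R).
  apply: measurableT_comp (measurable_value madm mstep _ _) _.
  by apply: measurableT_comp (measurable_run iN).
by move=> w; rewrite ger0_norm ?value_ge0 ?value_le.
Qed.

(** The horizon is the same on both sides and an acceptance only restricts the state; this makes the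
    variance bounds telescope. *)
Lemma run_value_decreasing i : (i < N)%N ->
  \int[P]_w V (N - i.+1) (run q i.+1 w).2 <=
  \int[P]_w V (N - i.+1) (run q i w).2.
Proof.
move=> iN; apply: le_Rintegral => //.
- exact: run_value_integrable.
- exact: run_value_integrable (ltnW iN).
move=> w _ /=; case: ifP => // qiw.
apply: (value_le_state madm mstep _ le_state_sim).
by apply: step_le; have [_] := qP iN; exact.
Qed.

Lemma best_prospect_second_moment i (c : R) : (i < N)%N -> 0 <= c <= N%:R ->
  \int[P]_w (best_prospect q i w - c) ^+ 2 <=
  \int[P]_w (prospect q i w - c) ^+ 2 + \int[P]_w V (N - i) (run q i w).2 -
  \int[P]_w V (N - i.+1) (run q i w).2.
Proof.
move=> iN cN; have iN' := ltnW iN.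
have sq_bound (x : R) : 0 <= x <= N%:R -> 0 <= (x - c) ^+ 2 <= N%:R ^+ 2.
  by move=> x0; rewrite sqr_ge0/=; nra.
have sqi : P.-integrable setT (EFin \o fun w => (prospect q i w - c) ^+ 2).
  apply: (@bounded_integrable _ _ _ _ _ (N%:R ^+ 2)).
    apply: measurable_funX; apply: measurable_funB => //.
    exact: measurable_prospect.
  move=> w; have /sq_bound/andP[? ?] := prospect_bounds w iN'.
  by rewrite ger0_norm.
have Vi k := @run_value_integrable i k iN'.
have sqVi := integrableD measurableT sqi (Vi (N - i)%N).
have sqVVi := integrableB measurableT sqVi (Vi (N - i.+1)%N).
pose h z := (prospect_after i z - c) ^+ 2.
have mh : measurable_fun setT h.
  apply: measurable_funX; apply: measurable_funB => //.
  exact: measurable_prospect_after.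
have hC w y : 0 <= h (run q i w, y) <= N%:R ^+ 2.
  by apply: sq_bound; exact: prospect_after_bounds.
rewrite (run_integral iN mh hC) -RintegralD// -RintegralB//.
apply: le_Rintegral => //.
  apply: (@bounded_integrable _ _ _ _ _ (N%:R ^+ 2)).
    have mE : measurable_fun setT (fun z =>
        (\int[law (N - i.+1)]_y (h (z, y))%:E)%E).
      apply: (measurable_fun_fubini_tonelli_F (EFin \o h)) => //.
        exact/measurable_EFinP.
      by move=> z; rewrite lee_fin sqr_ge0.
    have mF : measurable_fun setT (fun z => \int[law (N - i.+1)]_y h (z, y)).
      exact: measurableT_comp mE.
    exact: measurableT_comp mF (measurable_run iN').
  move=> w; rewrite ger0_norm; last first.
    by apply: Rintegral_ge0 => y _; exact: sqr_ge0.
  rewrite -[leRHS](Rintegral_probability_cst (law (N - i.+1))).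
  apply: le_Rintegral => //; last by move=> y _; have /andP[] := hC w y.
    apply: (@bounded_integrable _ _ _ _ _ (N%:R ^+ 2)).
      by apply: measurableT_comp mh _; exact: pair1_measurable.
    by move=> y; have /andP[? ?] := hC w y; rewrite ger0_norm.
  by apply: (@bounded_integrable _ _ _ _ _ `|N%:R ^+ 2|).
move=> w _; set u := run q i w.
have := value_second_moment madm mstep law le_state_sim step_le (N - i.+1)
  u.2 (u.1 - c).
rewrite subnSK// /prospect -/u (addrAC u.1 (V _ _)) => /(le_trans _); apply.
rewrite le_eqVlt; apply/orP; left; apply/eqP.
by apply: eq_Rintegral => y _; congr (_ ^+ 2); rewrite /prospect_after addrAC.
Qed.

Section optimal_policy.
Hypothesis q_opt : \int[P]_w (run q N w).1 = V N s0.

(** The means decrease from [V N s0] to the mean count, which is [V N s0] again by optimality, so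
    they are constant. *)
Lemma optimal_prospect_mean i : (i <= N)%N ->
  \int[P]_w prospect q i w = V N s0.
Proof.
move=> iN; apply/eqP; rewrite eq_le; apply/andP; split.
  rewrite -prospect_init.
  elim: i iN => [//|i IHi] iN; apply: le_trans (IHi (ltnW iN)).
  exact: prospect_decreasing.
rewrite -q_opt; under eq_Rintegral do rewrite -prospect_final.
(* Backward induction from the horizon, with [i = N - j]. *)
rewrite -(subKn iN); move: (N - i)%N (leq_subr i N) => j {i iN}.
elim: j => [|j IHj] jN; first by rewrite subn0.
apply: le_trans (IHj (ltnW jN)) _.
by have := @prospect_decreasing (N - j.+1); rewrite subnSK//; apply;
  exact: leq_subr.
Qed.

(** A nonnegative difference with zero mean vanishes almost surely. *)
Lemma optimal_prospect_step i : (i < N)%N ->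
  {ae P, forall w, prospect q i.+1 w = best_prospect q i w}.
Proof.
move=> iN; pose g w := best_prospect q i w - prospect q i.+1 w.
have gi := best_prospect_integrable iN; have pi := prospect_integrable iN.
have g0 w : 0 <= g w by rewrite subr_ge0; exact: prospect_step.
have : (\int[P]_w `|(g w)%:E| = 0)%E.
  under eq_integral do rewrite gee0_abs ?lee_fin//.
  rewrite integral_EFin_Rintegral; last first.
    by have := integrableB measurableT gi pi.
  rewrite RintegralB// best_prospect_mean// !optimal_prospect_mean ?subrr//.
  exact: ltnW.
have mg : measurable_fun setT (EFin \o g).
  apply/measurable_EFinP; apply: measurable_funB.
    exact: measurable_best_prospect.
  exact: measurable_prospect.
move/(ae_eq_integral_abs _ measurableT mg); apply: filterS => w /(_ I)/= [].
by move/eqP; rewrite subr_eq0 => /eqP.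
Qed.

(** The quantity [m i + r i], spread of the prospect plus mean remaining value, does not increase
    with [i]. It starts at [0 + c] and ends at the second moment plus 0. *)
Lemma optimal_second_moment :
  \int[P]_w ((run q N w).1 - V N s0) ^+ 2 <= V N s0.
Proof.
set c := V N s0.
have c0 : 0 <= c <= N%:R by rewrite /c value_ge0 ?value_le.
pose m i := \int[P]_w (prospect q i w - c) ^+ 2.
pose r i := \int[P]_w V (N - i) (run q i w).2.
have mS i : (i < N)%N -> m i.+1 + r i.+1 <= m i + r i.
  move=> iN.
  have -> : m i.+1 = \int[P]_w (best_prospect q i w - c) ^+ 2.
    rewrite /m /Rintegral; congr fine; apply: ge0_ae_eq_integral => //.
    - apply/measurable_EFinP/measurable_funX/measurable_funB => //.
      exact: measurable_prospect.
    - apply/measurable_EFinP/measurable_funX/measurable_funB => //.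
      exact: measurable_best_prospect.
    - by move=> w _; rewrite lee_fin sqr_ge0.
    - by move=> w _; rewrite lee_fin sqr_ge0.
    - by apply: filterS (optimal_prospect_step iN) => w -> _.
  have := best_prospect_second_moment iN c0; have := run_value_decreasing iN.
  by rewrite -/(m i) -/(r i) -/(r i.+1); lra.
have mN : m N + r N <= m 0%N + r 0%N.
  suff H i : (i <= N)%N -> m i + r i <= m 0%N + r 0%N by exact: H.
  elim: i => [//|i IHi] iN; exact: le_trans (mS i iN) (IHi (ltnW iN)).
have -> : \int[P]_w ((run q N w).1 - c) ^+ 2 = m N.
  by apply: eq_Rintegral => w _; rewrite prospect_final.
have rN : r N = 0.
  by rewrite /r subnn /=; exact: Rintegral_probability_cst.
have r0 : r 0%N = c by rewrite /r subn0 /=; exact: Rintegral_probability_cst.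
have m0 : m 0%N = 0.
  transitivity (\int[P]_w (0 : R)); last exact: Rintegral_probability_cst.
  by apply: eq_Rintegral => w _; rewrite /prospect /= subn0 add0r subrr expr0n.
lra.
Qed.

End optimal_policy.
End policy.

(** The Bellman decision needs the state and [run] needs the decision, so the state is first defined
    by a recursion of its own. *)
Definition bellman_state : nat -> T -> R * S :=
  fix go i w :=
    if i is j.+1 then
      let z := go j w in
      if adm (z.2, Y j w) &&
         (V (N - j.+1) z.2 <= 1 + V (N - j.+1) (step (z.2, Y j w)))
      then (z.1 + 1, step (z.2, Y j w)) else z
    else (0, s0).

Definition bellman_policy i w : bool :=
  let z := (bellman_state i w).2 in
  adm (z, Y i w) && (V (N - i.+1) z <= 1 + V (N - i.+1) (step (z, Y i w))).

Lemma run_bellman i w : run bellman_policy i w = bellman_state i w.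
Proof. by elim: i => //= i ->. Qed.

(** Strong induction: the decision at time [i] is measurable because the run before it is, which
    rests on the earlier decisions. *)
Lemma bellman_admissible : admissible_policy bellman_policy.
Proof.
move=> i; elim/ltn_ind: i => i IHi iN; split; last first.
  by move=> w; rewrite run_bellman => /andP[].
have mrun : measurable_fun [set: history_type Y i] (run bellman_policy i).
  by apply: run_history => j ji; have [] := IHi j ji (ltn_trans ji iN).
have mrunS : measurable_fun [set: history_type Y i.+1] (run bellman_policy i).
  move=> _ A mA; rewrite setTI; apply: historyS.
  by have := mrun measurableT _ mA; rewrite setTI.
have mS : measurable_fun [set: history_type Y i.+1]
    (fun w => (run bellman_policy i w).2) by exact: measurableT_comp.
have mz : measurable_fun [set: history_type Y i.+1]
    (fun w => ((run bellman_policy i w).2, Y i w)).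
  apply: measurable_fun_pair => //.
  by move=> _ A mA; rewrite setTI; exact: history_preimage.
have mV := measurable_value madm mstep law (N - i.+1).
have mpol : measurable_fun [set: history_type Y i.+1] (bellman_policy i).
  rewrite (_ : bellman_policy i = fun w =>
    adm ((run bellman_policy i w).2, Y i w) &&
    (V (N - i.+1) (run bellman_policy i w).2 <=
     1 + V (N - i.+1) (step ((run bellman_policy i w).2, Y i w)))); last first.
    by apply/funext => w; rewrite run_bellman.
  apply: measurable_and; first exact: measurableT_comp mz.
  apply: measurable_fun_ler; first exact: measurableT_comp mS.
  apply: measurable_funD => //.
  apply: (measurableT_comp mV); exact: measurableT_comp mz.
have := mpol measurableT [set true] I; rewrite setTI.
by congr (history _ _ _); apply/seteqP; split.
Qed.

Lemma bellman_optimal : \int[P]_w (run bellman_policy N w).1 = V N s0.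
Proof.
apply: count_mean_eq; first exact: bellman_admissible.
move=> i w iN; set z := (run bellman_policy i w).2.
have qE : bellman_policy i w = adm (z, Y i w) &&
    (V (N - i.+1) z <= 1 + V (N - i.+1) (step (z, Y i w))).
  by rewrite /z run_bellman.
rewrite /prospect /best_prospect /prospect_after /= /gain qE -/z /=.
case: (boolP (adm _)) => //= _.
by case: (leP (V _ z)) => _ /=; rewrite ?addrA.
Qed.

End process.

(** * Independence of an observation from the past *)

Section history_independence.
Context d (T : measurableType d) (R : realType) (P : probability T R).
Variables (n : nat) (X : 'I_n -> {RV P >-> R}) (Y : nat -> {RV P >-> R}).
Hypothesis X_indep : mutually_independent X.
Hypothesis YX : forall i : 'I_n, Y i = X i.

Let past_set (i : nat) : {set 'I_n} := [set j : 'I_n | (j < i)%N]%SET.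

Let past_cylinder (i : nat) (B : 'I_n -> set R) : set T :=
  \bigcap_(j in [set j | j \in past_set i]) (X j @^-1` B j).

Let cylinders (i : nat) : set (set T) :=
  [set past_cylinder i B | B in [set B | forall j, measurable (B j)]].

Let cylindersI i : setI_closed (cylinders i).
Proof.
move=> _ _ [B mB <-] [C mC <-]; exists (fun j => B j `&` C j).
  by move=> j; exact: measurableI.
rewrite /past_cylinder -bigcapI; apply: eq_bigcapr => j _.
by rewrite preimage_setI.
Qed.

Let cylindersT i : cylinders i setT.
Proof.
exists (fun=> setT) => //; rewrite /past_cylinder.
by apply/seteqP; split => // w _ j _.
Qed.

Let cylinders_measurable i : cylinders i `<=` measurable.
Proof.
move=> _ [B mB <-]; apply: fin_bigcap_measurable; first exact: finite_finset.
by move=> j _; exact: measurable_funPTI.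
Qed.

Let history_cylinders i : (i <= n)%N -> history Y i `<=` <<s cylinders i >>.
Proof.
move=> ii; apply: sub_smallest2r; first exact: smallest_sigma_algebra.
rewrite history_eventsE; apply: bigcup_sub => j /= ji _ [B mB <-].
pose k := Ordinal (leq_trans ji ii).
exists (fun l => if l == k then B else setT) => [l|]; first by case: ifP.
rewrite setTI /past_cylinder; apply/seteqP; split => w /=.
  by move=> /(_ k); rewrite eqxx -YX /=; apply; rewrite inE.
by move=> Bw l _; case: eqP => // ->; rewrite -YX.
Qed.

(** As functions of [A], both sides are finite measures. They agree on the cylinders of the first
    [i] observations, a class closed under intersection whose sigma-algebra contains the past. *)
Lemma history_independent i : (i < n)%N -> forall A B,
  history Y i A -> measurable B ->
  P (A `&` Y i @^-1` B) = (P A * P (Y i @^-1` B))%E.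
Proof.
move=> ii A B hA mB; pose k := Ordinal ii.
have mD : measurable (Y i @^-1` B) by exact: measurable_funPTI.
have PD0 : 0 <= fine (P (Y i @^-1` B)) by rewrite fine_ge0.
pose m2 := mscale (NngNum PD0) P.
have m2E C : m2 C = (P C * P (Y i @^-1` B))%E.
  by rewrite /m2 /mscale/= fineK ?fin_num_measure// muleC.
rewrite -m2E -/(mrestr P mD A).
apply: (g_sigma_algebra_measure_unique (cylinders i)
  (@cylinders_measurable i) (fun=> setT)) => //.
- by rewrite bigcup_const.
- move=> _ [C mC <-]; apply: etrans _ (esym (m2E _)).
  change (P (past_cylinder i C `&` Y i @^-1` B) =
    P (past_cylinder i C) * P (Y i @^-1` B))%E.
  (* Adding the index [k] with the event [B] makes the left side one instance of mutual
     independence. *)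
  pose J := (k |: past_set i)%SET.
  pose D l := if l == k then B else C l.
  have kN : k \notin past_set i by rewrite inE ltnn.
  have DE l : l \in past_set i -> D l = C l.
    by rewrite /D; case: eqP => // ->; rewrite (negbTE kN).
  have mDl l : measurable (D l) by rewrite /D; case: ifP.
  have PE : P (past_cylinder i C) =
      (\prod_(l in past_set i) P (X l @^-1` D l))%E.
    rewrite -X_indep//; congr (P _); apply: eq_bigcapr => l /= li.
    by rewrite DE.
  have -> : past_cylinder i C `&` Y i @^-1` B =
      \bigcap_(l in [set l | l \in J]) (X l @^-1` D l).
    apply/seteqP; split => [w [Cw Bw] l /=|w Jw].
      rewrite !inE => /orP[/eqP ->|li]; first by rewrite /D eqxx -YX.
      by rewrite DE ?inE//; apply: Cw; rewrite /= inE.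
    split.
      move=> l /= li; rewrite -DE//; apply: Jw.
      by rewrite /= !inE; move: li; rewrite inE => ->; rewrite orbT.
    by have := Jw k; rewrite /= /D eqxx -YX; apply; rewrite !inE eqxx.
  rewrite X_indep// big_setU1//= PE muleC; congr (_ * _)%E.
  by rewrite /D eqxx -YX.
- move=> _; change (P (setT `&` Y i @^-1` B) < +oo)%E.
  by rewrite setTI (le_lt_trans (probability_le1 _ _))// ltry.
- exact: history_cylinders (ltnW ii) _ hA.
Qed.

End history_independence.

(** * Unimodal sequences *)

Section unimodal_states.
Context (R : realType).

(* A state holds the last accepted value, [-oo] before any acceptance, and
   whether the accepted values are still nondecreasing. *)
(* A state holds the last accepted value, [-oo] before any acceptance, and
   whether the accepted values are still nondecreasing. *)
Definition uadm (z : (\bar R * bool) * R) : bool :=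
  z.1.2 || (z.2%:E <= z.1.1)%E.

Definition ustep (z : (\bar R * bool) * R) : \bar R * bool :=
  (z.2%:E, z.1.2 && (z.1.1 <= z.2%:E)%E).

Let m11 : measurable_fun setT (fun z : (\bar R * bool) * R => z.1.1).
Proof. exact: measurableT_comp. Qed.

Let m12 : measurable_fun setT (fun z : (\bar R * bool) * R => z.1.2).
Proof. exact: measurableT_comp. Qed.

Let m2 : measurable_fun setT (fun z : (\bar R * bool) * R => (z.2)%:E).
Proof. exact: measurableT_comp. Qed.

Lemma measurable_uadm : measurable_fun setT uadm.
Proof. by apply: measurable_or => //; exact: measurable_fun_lee. Qed.

Lemma measurable_ustep : measurable_fun setT ustep.
Proof.
apply: measurable_fun_pair => //; apply: measurable_and => //.
exact: measurable_fun_lee.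
Qed.

(** An increasing state admits every value, so it dominates all decreasing ones; a lower last value
    leaves more room to climb, a higher one more room to descend. *)
Definition le_ustate (s t : \bar R * bool) : Prop :=
  match s.2, t.2 with
  | true, true => (t.1 <= s.1)%E
  | false, true => True
  | false, false => (s.1 <= t.1)%E
  | true, false => False
  end.

Lemma le_ustate_sim s t : le_ustate s t -> forall y, uadm (s, y) ->
  uadm (t, y) /\ le_ustate (ustep (s, y)) (ustep (t, y)).
Proof.
case: s t => [e []] [f []]; rewrite /le_ustate /uadm /ustep //=.
- move=> fe y _; split => //; case: (leP e y%:E) => ey; last by case: ifP.
  by rewrite (le_trans fe ey).
- by move=> _ y _; case: ifP.
- by move=> ef y ye; rewrite (le_trans ye ef) lexx.
Qed.

Lemma ustep_le s y : uadm (s, y) -> le_ustate (ustep (s, y)) s.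
Proof. by case: s => e []; rewrite /le_ustate /uadm /ustep//=; case: leP. Qed.

Fixpoint uvalid (s : \bar R * bool) (l : seq R) : bool :=
  if l is y :: l' then uadm (s, y) && uvalid (ustep (s, y)) l' else true.

Definition urun (s : \bar R * bool) (l : seq R) : \bar R * bool :=
  foldl (fun s y => ustep (s, y)) s l.

Lemma uvalid_cat s l1 l2 :
  uvalid s (l1 ++ l2) = uvalid s l1 && uvalid (urun s l1) l2.
Proof. by elim: l1 s => //= y l1 IH s; rewrite IH andbA. Qed.

Lemma uvalid_down x l : uvalid (x%:E, false) l = path >=%R x l.
Proof. by elim: l x => //= y l IH x; rewrite /uadm /ustep/= IH lee_fin. Qed.

(** If the second entry is not below the first, a mode can be sought from the second on; otherwise
    the first is the mode and the rest must descend. *)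
Lemma uvalid_up x l : unimodal (x :: l) <-> uvalid (x%:E, true) l.
Proof.
elim: l x => [|y l IHl] x /=; first by split => // _; exists 1%N.
rewrite /ustep /uadm /= lee_fin; case: (leP x y) => xy.
  apply: iff_trans (IHl y); split => [[[|[|t]] []]//= | [[|t] []]//=].
  - by move=> _ _ /andP[_ yl]; exists 1%N; split; rewrite //= take0.
  - by move=> tl /andP[_ yl] dl; exists t.+1.
  - by move=> tl yl dl; exists t.+2; split => //=; rewrite xy.
rewrite uvalid_down; split => [[[|[|t]] []]//= | yl].
- by move=> _ _ /andP[].
- by rewrite leNgt xy.
- by exists 1%N; split => //=; rewrite ?take0 ?(ltW xy).
Qed.

Lemma unimodalP (l : seq R) :
  unimodal l <-> l != [::] /\ uvalid (-oo%E, true) l.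
Proof.
case: l => [|x l]; first by split => [[[|t] []]|[]].
apply: iff_trans (uvalid_up x l) _.
by rewrite /= /uadm /ustep leNye; split => [|[]].
Qed.

End unimodal_states.

(** * Feasible policies as runs on unimodal states *)

Section unimodal_policies.
Context d (T : measurableType d) (R : realType) (P : probability T R) (m : nat).
Variable X : 'I_m.+1 -> {RV P >-> R}.

(** Indices range over [nat]; the default of [inord] beyond [m] is never read by a run of length
    [m.+1]. *)
Definition observation (i : nat) : {RV P >-> R} := X (inord i).

Definition ustart : \bar R * bool := (-oo%E, true).

Local Notation Y := observation.
Local Notation urunp := (run (@ustep R) Y ustart).

Definition chosen (q : nat -> T -> bool) (i : nat) (w : T) : seq R :=
  [seq Y j w | j <- iota 0 i & q j w].

Lemma chosenS q i w :
  chosen q i.+1 w =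
  if q i w then rcons (chosen q i w) (Y i w) else chosen q i w.
Proof.
rewrite /chosen -[i.+1]addn1 iotaD add0n filter_cat map_cat /=.
by case: ifP; rewrite ?cats1 ?cats0.
Qed.

Lemma run_chosen q i w :
  urunp q i w = ((size (chosen q i w))%:R, urun ustart (chosen q i w)).
Proof.
elim: i => //= i ->; rewrite chosenS; case: ifP => //= _.
by rewrite size_rcons -natr1 /urun foldl_rcons.
Qed.

Lemma selected_chosen (pi : policy T m.+1) q w :
  (forall i, pi i w = q (val i) w) ->
  [seq X i w | i <- selected pi w] = chosen q m.+1 w.
Proof.
move=> piq; rewrite /chosen -val_enum_ord filter_map -map_comp.
rewrite /selected (eq_filter piq); apply: eq_map => i /=.
by rewrite /Y inord_val.
Qed.

Lemma U_run (pi : policy T m.+1) q w :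
  (forall i, pi i w = q (val i) w) -> U R pi w = (urunp q m.+1 w).1.
Proof.
by move=> piq; rewrite run_chosen /= -(selected_chosen piq) size_map.
Qed.

Lemma past_history (i : 'I_m.+1) : past (fun i => X i) i = history Y i.+1.
Proof.
rewrite /past /g_sigma_preimage /history /history_events; congr (<<s _ >>).
apply: eq_bigr => j _; rewrite /Y; congr (preimage_set_system _ (X _) _).
by apply: val_inj; rewrite /= inordK// (leq_trans (ltn_ord j)).
Qed.

Lemma feasible_admissible (pi : policy T m.+1) :
  feasible (fun i => X i) pi ->
  admissible_policy (@uadm R) (@ustep R) Y m.+1 ustart (fun i => pi (inord i)).
Proof.
move=> [pi_adapted pi_uni] i iN; split.
  by have := pi_adapted (inord i); rewrite past_history inordK.
move=> w piw; have /unimodalP[_] := pi_uni w.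
rewrite (@selected_chosen _ (fun i => pi (inord i))); last first.
  by move=> k; rewrite inord_val.
(* The selection is cut right after time [i], so that the value accepted at time [i] ends the
   prefix. *)
rewrite /chosen -{1}(subnKC iN) iotaD filter_cat map_cat uvalid_cat.
rewrite -/(chosen (fun i => pi (inord i)) i.+1 w) chosenS piw -cats1.
rewrite uvalid_cat => /andP[/andP[_]].
by rewrite run_chosen/= andbT.
Qed.

Lemma bellman_feasible :
  feasible (fun i => X i) (fun i : 'I_m.+1 =>
    bellman_policy (@uadm R) (@ustep R) Y m.+1 ustart i).
Proof.
set q := bellman_policy _ _ _ _ _.
have qP : admissible_policy (@uadm R) (@ustep R) Y m.+1 ustart q.
  exact: (bellman_admissible (@measurable_uadm R) (@measurable_ustep R)).
split => [i|w]; first by rewrite past_history; have [] := qP _ (ltn_ord i).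
have valid i : (i <= m.+1)%N -> uvalid ustart (chosen q i w).
  elim: i => // i IHi iN; have := IHi (ltnW iN); rewrite chosenS.
  case: ifP => // qiw valid_i; rewrite -cats1 uvalid_cat valid_i /= andbT.
  by have [_ /(_ _ qiw)] := qP _ iN; rewrite run_chosen.
rewrite (@selected_chosen _ q)//; apply/unimodalP; split; last exact: valid.
(* [unimodal] excludes the empty list. If nothing was accepted earlier, the last observation is
   admissible and, with no future left, is accepted. *)
rewrite chosenS; case: ifPn => [_|]; first by case: (chosen _ _ _).
apply: contraNneq => chosen0; rewrite /q /bellman_policy -run_bellman -/q.
by rewrite run_chosen chosen0 subnn /uadm /=.
Qed.

End unimodal_policies.

(** * The bound on the mean *)

Section diagonal_bound.
Context (R : realType) (mu : probability R R).
Variables (A : set R) (r : R * R -> bool) (c : R -> R) (C : R).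
Hypothesis mA : measurable A.
Hypothesis mr : measurable_fun setT r.
Hypothesis r_total : forall x y, A x -> A y -> r (x, y) || r (y, x).
Hypothesis mc : measurable_fun setT c.
Hypothesis c_bound : forall y, `|c y| <= C.
Hypothesis rc : forall y, A y ->
  (mu (A `&` [set y' | r (y, y')]) <= (c y)%:E)%E.

Let J := (\int[mu]_y (\1_A y * c y))%:E.

Let E := [set z : R * R | [/\ A z.1, A z.2 & r z]].

Let E' := [set z : R * R | [/\ A z.1, A z.2 & r (z.2, z.1)]].

Let mE : measurable E.
Proof.
rewrite (_ : E = (A `*` A) `&` (setT `&` r @^-1` [set true])).
  by apply: measurableI; [exact: measurableX|exact: mr].
by rewrite setTI; apply/seteqP; split => [z [? ? ?]|z [[? ?] ?]].
Qed.

Let mE' : measurable E'.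
Proof.
have -> : E' = setT `&` (fun z => (z.2, z.1)) @^-1` E.
  by rewrite setTI; apply/seteqP; split => z [? ? ?].
have mswap : measurable_fun setT (fun z : R * R => (z.2, z.1)).
  exact: measurable_fun_pair.
exact: mswap.
Qed.

Let muE : ((mu \x mu) E <= J)%E.
Proof.
have ci : mu.-integrable setT (EFin \o fun y => \1_A y * c y).
  apply: (@bounded_integrable _ _ _ _ _ C); first exact: measurable_funM.
  move=> y; rewrite indicE; case: (y \in A); rewrite ?mul1r ?mul0r//.
  by rewrite normr0 (le_trans _ (c_bound y)).
rewrite /J -integral_EFin_Rintegral//; apply: ge0_le_integral => //.
- exact: measurable_fun_xsection.
- exact/measurable_EFinP/measurable_funM.
move=> x _ /=; rewrite indicE; have [/set_mem xA|xA] := boolP (x \in A).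
  rewrite mul1r; apply: le_trans (rc xA); apply: le_measure; rewrite ?inE.
  - exact: measurable_xsection.
  - apply: measurableI => //; rewrite -[X in measurable X]setTI.
    have mrx : measurable_fun setT (fun y => r (x, y)).
      by apply: measurableT_comp mr _; exact: pair1_measurable.
    exact: mrx.
  - by move=> y /xsectionP[_ yA rxy].
rewrite mul0r (_ : xsection E x = set0) ?measure0//.
by apply/seteqP; split => // y /xsectionP[/= /mem_set]; rewrite (negbTE xA).
Qed.

(** Slicing [E'] in the other order gives the sections of [E], and both orders define the same
    product measure. *)
Let muE' : (mu \x mu)%E E' = (mu \x mu)%E E.
Proof.
transitivity ((mu \x^ mu)%E E').
  by apply: product_measure_unique => //= *; rewrite product_measure2E.
apply: eq_integral => y _ /=; congr (mu _).
by apply/seteqP; split => x; rewrite /xsection /ysection/= !inE => -[].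
Qed.

(* The pairs related by [r] and the pairs related by its converse fill
   [A `*` A], have the same [mu \x mu]-measure, and by Tonelli this measure is
   at most the integral of [c] over [A]. *)
Lemma diagonal_bound :
  fine (mu A) ^+ 2 / 2 <= \int[mu]_y (\1_A y * c y).
Proof.
have : (mu A * mu A <= J + J)%E.
  rewrite -product_measure1E//.
  have -> : A `*` A = E `|` E'.
    apply/seteqP; split => [[x y] [xA yA]|z [[]|[]]//].
    by have /orP[] := r_total xA yA; [left|right].
  have muE'J : ((mu \x mu) E' <= J)%E by rewrite muE'.
  by apply: le_trans (measureU2 _ mE mE') _; exact: leeD.
rewrite -[mu A]fineK ?fin_num_measure// /J -EFinD -EFinM lee_fin expr2.
by move=> /= ?; lra.
Qed.

End diagonal_bound.

(** * Continuous distribution functions and variation costs *)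

Section continuous_cdf.
Context (R : realType) (F : R -> R).
Hypothesis F_continuous : continuous F.

Definition has_cdf (mu : probability R R) : Prop :=
  forall x, mu `]-oo, x]%classic = (F x)%:E.

Definition ecdf (e : \bar R) : R :=
  match e with x%:E => F x | +oo%E => 1 | -oo%E => 0 end.

Section law.
Variable mu : probability R R.
Hypothesis muF : has_cdf mu.

Lemma cdf_bounds x : 0 <= F x <= 1.
Proof. by rewrite -!lee_fin -muF measure_ge0 probability_le1. Qed.

Lemma ecdf_bounds e : 0 <= ecdf e <= 1.
Proof. by case: e => [x| |] /=; rewrite ?cdf_bounds ?lexx ?ler01. Qed.

(** There is no atom at [x]: the mass is at least [F (x - t / 2)], which by continuity is
    arbitrarily close to [F x]. *)
Lemma probability_lt x : mu `]-oo, x[%classic = (F x)%:E.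
Proof.
have le1 : (mu `]-oo, x[%classic <= (F x)%:E)%E.
  rewrite -muF; apply: le_measure; rewrite ?inE//.
  by move=> z /=; rewrite !in_itv/= => /ltW.
apply/eqP; rewrite eq_le le1/= -[leRHS]fineK ?fin_num_measure// lee_fin.
have /cvgrPdist_lt Fx : F y @[y --> x] --> F x by exact: F_continuous.
apply/ler_addgt0Pr => e /Fx.
move=> /nbhs_ballP[t /= t0 Ft].
have /Ft : ball x t (x - t / 2).
  by rewrite /ball/= opprB addrCA subrr addr0 gtr0_norm//; lra.
move=> /(le_lt_trans (ler_norm _)).
have : F (x - t / 2) <= fine (mu `]-oo, x[%classic).
  rewrite -lee_fin fineK ?fin_num_measure// -muF.
  apply: le_measure; rewrite ?inE//.
  by move=> z /=; rewrite !in_itv/= => zx; apply: le_lt_trans zx _; lra.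
lra.
Qed.

Lemma probability_ele e : mu [set y | (y%:E <= e)%E] = (ecdf e)%:E.
Proof.
case: e => [x| |] /=.
- by rewrite -muF.
- rewrite -[RHS](probability_setT mu); congr (mu _); apply/seteqP.
  by split => y //= _; rewrite leey.
- rewrite -[RHS](measure0 mu); congr (mu _); apply/seteqP.
  by split => y //=; rewrite leeNy_eq.
Qed.

Lemma probability_elt e : mu [set y | (y%:E < e)%E] = (ecdf e)%:E.
Proof.
case: e => [x| |] /=.
- by rewrite -probability_lt.
- rewrite -[RHS](probability_setT mu); congr (mu _); apply/seteqP.
  by split => y //= _; rewrite ltry.
- rewrite -[RHS](measure0 mu); congr (mu _); apply/seteqP.
  by split => y //=.
Qed.

Lemma measurable_ele e : measurable [set y : R | (y%:E <= e)%E].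
Proof.
by rewrite -[X in measurable X]setTI; exact: measurable_lee.
Qed.

Lemma measurable_elt e : measurable [set y : R | (y%:E < e)%E].
Proof.
by rewrite -[X in measurable X]setTI; exact: measurable_lte.
Qed.

Lemma probability_interval (a b : \bar R) : (a <= b)%E ->
  mu [set y | (a <= y%:E <= b)%E] = (ecdf b - ecdf a)%:E.
Proof.
move=> ab; rewrite (_ : [set y | _] =
    [set y | (y%:E <= b)%E] `\` [set y | (y%:E < a)%E]); last first.
  apply/seteqP; split => y /=; first by move=> /andP[ay ->]; rewrite ltNge ay.
  by move=> [-> /negP]; rewrite -leNgt => ->.
rewrite measureD; [|exact: measurable_ele|exact: measurable_elt|]; last first.
  by rewrite (le_lt_trans (probability_le1 _ (measurable_ele _)))// ltry.
rewrite setIidr; last by move=> y /= /ltW /le_trans; apply.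
exact: (congr2 (fun u v => u - v)%E (probability_ele b) (probability_elt a)).
Qed.

End law.

(* The most that [F] can still vary along the values accepted from [s]: from
   an increasing state it may climb to 1 and come back down to 0. *)
(* The most that [F] can still vary along the values accepted from [s]: from
   an increasing state it may climb to 1 and come back down to 0. *)
Definition variation (s : \bar R * bool) : R :=
  if s.2 then 2 - ecdf s.1 else ecdf s.1.

Definition variation_cost (s : \bar R * bool) (y : R) : R :=
  variation s - variation (ustep (s, y)).

(* [cheaper s (y, y')] means that, from [s], accepting [y'] costs at most as
   much [variation] as accepting [y]. *)
Definition cheaper (s : \bar R * bool) (z : R * R) : bool :=
  if s.2 && (s.1 <= z.1%:E)%E then (s.1 <= z.2%:E)%E && (z.2 <= z.1)
  else z.1 <= z.2.

Lemma measurable_cheaper s : measurable_fun setT (cheaper s).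
Proof.
have m1 : measurable_fun setT (fun z : R * R => (z.1)%:E).
  exact: measurableT_comp.
have m2 : measurable_fun setT (fun z : R * R => (z.2)%:E).
  exact: measurableT_comp.
apply: measurable_fun_ifT; last exact: measurable_fun_ler.
- by apply: measurable_and => //; exact: measurable_fun_lee.
- apply: measurable_and; first exact: measurable_fun_lee.
  exact: measurable_fun_ler.
Qed.

Lemma cheaper_total s x y : cheaper s (x, y) || cheaper s (y, x).
Proof.
rewrite /cheaper /=; case: s.2 => /=; last exact: le_total.
case: (leP s.1 x%:E) => sx; case: (leP s.1 y%:E) => sy /=.
- exact: le_total.
- by rewrite -lee_fin (ltW (lt_le_trans sy sx)).
- by rewrite -lee_fin (ltW (lt_le_trans sx sy)).
- exact: le_total.
Qed.

Section law_cost.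
Variable mu : probability R R.
Hypothesis muF : has_cdf mu.

Lemma variation_bounds s : 0 <= variation s <= 2.
Proof. by have := ecdf_bounds muF s.1; rewrite /variation; case: s.2; lra. Qed.

Lemma measurable_variation_cost s : measurable_fun setT (variation_cost s).
Proof.
have mF : measurable_fun setT F by exact: continuous_measurable_fun.
apply: measurable_funB => //; rewrite /variation /ustep /=.
apply: measurable_fun_ifT => //; last exact: measurable_funB.
by apply: measurable_and => //; apply: measurable_fun_lee => //;
  exact: EFin_measurable.
Qed.

(** From an increasing state with [e <= y], cheaper values lie in [[e, y]], whose probability is
    exactly the cost; from a decreasing state, in [[y, e]], likewise. A drop from an increasing
    state costs [2 - ecdf e - F y >= 1 - F y], and cheaper values are then at least [y]. *)
Lemma cheaper_cost s A y : measurable A -> A `<=` [set y | uadm (s, y)] ->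
  A y -> (mu (A `&` [set y' | cheaper s (y, y')]) <= (variation_cost s y)%:E)%E.
Proof.
move=> mA Aadm Ay; have sy := Aadm _ Ay.
have mAr : measurable (A `&` [set y' | cheaper s (y, y')]).
  apply: measurableI => //; rewrite -[X in measurable X]setTI.
  have mc : measurable_fun setT (fun y' => cheaper s (y, y')).
    apply: measurableT_comp (measurable_cheaper s) _.
    exact: pair1_measurable.
  exact: mc.
have mi a b : measurable [set y : R | (a <= y%:E <= b)%E].
  rewrite (_ : [set y | _] =
      ~` [set y | (y%:E < a)%E] `&` [set y | (y%:E <= b)%E]).
    apply: measurableI; last exact: measurable_ele.
    by apply: measurableC; exact: measurable_elt.
  apply/seteqP; split => z /= => [/andP[az ->]|[/negP + ->]].
    by split => //; apply/negP; rewrite -leNgt.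
  by rewrite -leNgt => ->.
rewrite /variation_cost /ustep /cheaper /variation.
case: s Aadm sy => e [] /= Aadm sy in mAr *.
- case: (leP e y%:E) => ey.
    rewrite (_ : 2 - _ - _ = ecdf y%:E - ecdf e); last by rewrite /=; ring.
    rewrite -(probability_interval muF ey); apply: le_measure; rewrite ?inE//.
    by move: mAr; rewrite /cheaper /= ey.
  apply: (@le_trans _ _ (ecdf +oo%E - ecdf y%:E)%:E); last first.
    by rewrite lee_fin /=; have := ecdf_bounds muF e; lra.
  rewrite -(probability_interval muF (leey _)).
  apply: le_measure; rewrite ?inE//.
    by move: mAr; rewrite /cheaper /= leNgt ey.
  by move=> z /= [_ yz]; rewrite lee_fin yz leey.
- move: sy; rewrite /uadm/= => ye.
  rewrite -(probability_interval muF ye); apply: le_measure; rewrite ?inE//.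
  by move=> z /= [/Aadm] /=; rewrite /uadm/= lee_fin => -> ->.
Qed.

Lemma variation_cost_mean s A :
  measurable A -> A `<=` [set y | uadm (s, y)] ->
  fine (mu A) ^+ 2 / 2 <= \int[mu]_y (\1_A y * variation_cost s y).
Proof.
move=> mA Aadm; apply: (@diagonal_bound _ _ _ (cheaper s) _ 2) => //.
- exact: measurable_cheaper.
- by move=> x y _ _; exact: cheaper_total.
- exact: measurable_variation_cost.
- move=> y; rewrite /variation_cost ler_norml.
  by have := variation_bounds s; have := variation_bounds (ustep (s, y)); lra.
- by move=> y; exact: cheaper_cost.
Qed.

End law_cost.

Variable mu : nat -> probability R R.
Hypothesis muF : forall k, has_cdf (mu k).

Local Notation V := (value (@uadm R) (@ustep R) mu).

(** With one observation left the value is the probability of an admissible one: at most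
    [1 <= 2 - ecdf e] while increasing, and exactly [ecdf e] afterwards. *)
Lemma value1_le s : V 1 s <= variation s.
Proof.
have V1 := value_le (@measurable_uadm R) (@measurable_ustep R) mu 1 s.
rewrite /variation; case: s V1 => e [] V1 /=.
  by have := ecdf_bounds (muF 0) e; rewrite /= in V1; lra.
have -> : \int[mu 0]_y gain (@uadm R) (@ustep R) (cst 0) ((e, false), y) =
    \int[mu 0]_y \1_[set y | (y%:E <= e)%E] y.
  apply: eq_Rintegral => y _.
  rewrite /gain /uadm /= indicE addr0 max_r ?ler01//.
  have [ye|ye] := boolP (y%:E <= e)%E; first by rewrite mem_set.
  by rewrite memNset//; exact/negP.
rewrite /Rintegral integral_indic// ?setIT; last exact: measurable_ele.
by have := congr1 fine (probability_ele (muF 0) e) => /= ->.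
Qed.

(** By the assumed bound, accepting [y] exceeds [b = a + variation s / l] by at most
    [1 - variation_cost s y / l], which is nonnegative exactly when the cost is at most [l]. So the
    gain is at most [b] plus this amount on [A], and [variation_cost_mean] bounds its mean. *)
Lemma value_step_le k (l a : R) : 0 < l ->
  (forall s, V k s <= a + variation s / l) ->
  forall s, V k.+1 s <= a + l / 2 + variation s / l.
Proof.
move=> l0 Va s; pose A := [set y | uadm (s, y) && (variation_cost s y <= l)].
have mc := measurable_variation_cost s.
have mA : measurable A.
  rewrite -[X in measurable X]setTI.
  have mf : measurable_fun setT
      (fun y => uadm (s, y) && (variation_cost s y <= l)).
    apply: measurable_and; last exact: measurable_fun_ler.
    by apply: measurableT_comp (@measurable_uadm R) _; exact: pair1_measurable.
  exact: mf.
have Aadm : A `<=` [set y | uadm (s, y)] by move=> y /andP[].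
have m1A : measurable_fun setT (\1_A : R -> R) by exact: measurable_indic.
pose p := fine (mu k A); pose b := a + variation s / l.
have intA : (mu k).-integrable setT (EFin \o (\1_A : R -> R)).
  apply: (@bounded_integrable _ _ _ _ _ 1) => // y; rewrite indicE.
  by case: (_ \in _); rewrite ?normr1 ?normr0.
have intAc : (mu k).-integrable setT
    (EFin \o fun y => \1_A y * variation_cost s y).
  apply: (@bounded_integrable _ _ _ _ _ 2); first exact: measurable_funM.
  move=> y; rewrite ler_norml indicE /variation_cost.
  have := variation_bounds (muF k) s.
  have := variation_bounds (muF k) (ustep (s, y)).
  by case: (_ \in _); rewrite /=; lra.
have intb : (mu k).-integrable setT (EFin \o fun=> b).
  by apply: (@bounded_integrable _ _ _ _ _ `|b|).
have intc : (mu k).-integrable setT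
    (EFin \o fun y => l^-1 * (\1_A y * variation_cost s y)).
  by have := integrableZl measurableT l^-1 intAc.
have intbA : (mu k).-integrable setT (EFin \o fun y => b + \1_A y).
  by have := integrableD measurableT intb intA.
apply: (@le_trans _ _ (\int[mu k]_y
    (b + \1_A y - l^-1 * (\1_A y * variation_cost s y)))).
  rewrite valueS; apply: le_Rintegral => //.
  - exact: (gain_value_integrable (@measurable_uadm R) (@measurable_ustep R)).
  - by have := integrableB measurableT intbA intc.
  move=> y _; move: (V k) Va => W Va.
  have := Va s; have := Va (ustep (s, y)).
  have -> : variation (ustep (s, y)) = variation s - variation_cost s y.
    by rewrite /variation_cost; ring.
  rewrite /gain /b indicE.
  have [/set_mem/andP[sy cl]|/negP yA] := boolP (y \in A).
    have cl1 : l^-1 * (1 * variation_cost s y) <= 1.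
      by rewrite mul1r mulrC ler_pdivrMr// mul1r.
    rewrite sy /= mulrBl => V1 V2; rewrite ge_max; apply/andP; split.
      apply: le_trans V2 _; move: cl1; set q := l^-1 * _; lra.
    apply: le_trans (lerD (lexx 1) V1) _.
    by rewrite mul1r [l^-1 * _]mulrC; lra.
  rewrite /= mul0r mulr0 addr0 subr0; case: ifPn => [sy|_ _ //] V1 V2.
  rewrite ge_max V2 /=; apply: le_trans (lerD (lexx 1) V1) _.
  have : 1 <= variation_cost s y / l.
    rewrite ler_pdivlMr// mul1r leNgt; apply/negP => cl; apply: yA.
    by apply/mem_set; rewrite /A /= sy ltW.
  by move=> ?; rewrite [(_ - _) / l]mulrBl; lra.
rewrite RintegralB// RintegralD// RintegralZl// Rintegral_probability_cst.
have -> : \int[mu k]_y \1_A y = p by rewrite /Rintegral integral_indic// setIT.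
have := variation_cost_mean (muF k) mA Aadm; rewrite -/p.
set c := \int[mu k]_y _ => pc.
have : l^-1 * (p ^+ 2 / 2) <= l^-1 * c by rewrite ler_pM2l ?invr_gt0.
have : p - l^-1 * (p ^+ 2 / 2) <= l / 2.
  rewrite -subr_ge0.
  rewrite (_ : _ - _ = l^-1 * ((l - p) ^+ 2 / 2)); last first.
    by field; rewrite gt_eqF.
  by rewrite mulr_ge0 ?invr_ge0 ?(ltW l0)// divr_ge0 ?sqr_ge0.
rewrite /b; lra.
Qed.

Lemma value_lt n : V n.+1 (ustart R) < 2 * Num.sqrt n.+1%:R.
Proof.
(* This [l] balances the two terms [n.+1 * l / 2] and [2 / l]: both equal [r]. *)
pose r : R := Num.sqrt n.+1%:R; pose l := 2 / r.
have r0 : 0 < r by rewrite sqrtr_gt0 ltr0n.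
have l0 : 0 < l by rewrite divr_gt0.
have rr : r ^+ 2 = n.+1%:R by rewrite sqr_sqrtr// ler0n.
(* The least value over [v >= 0] of [l / 2 + v / l - min 1 v], reached at [v = 0] or [v = 1]. *)
pose dl := Num.min (l / 2) (l / 2 + l^-1 - 1).
have dl0 : 0 < dl.
  rewrite lt_min divr_gt0//= (_ : _ - 1 = ((l - 1) ^+ 2 + 1) / (2 * l)).
    apply: divr_gt0; last exact: mulr_gt0.
    by have := sqr_ge0 (l - 1); lra.
  by field; rewrite gt_eqF.
have V1 s : V 1 s <= l / 2 - dl + variation s / l.
  have := value1_le s.
  have := value_le (@measurable_uadm R) (@measurable_ustep R) mu 1 s.
  have := value_ge0 (@measurable_uadm R) (@measurable_ustep R) mu 1 s.
  set v := V 1 s => v0 v1 /(ler_wpM2r (ltW (_ : 0 < l^-1))).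
  rewrite invr_gt0 => /(_ l0) vl.
  have d1 : dl <= l / 2 by rewrite ge_min lexx.
  have d2 : dl <= l / 2 + l^-1 - 1 by rewrite ge_min lexx orbT.
  by nra.
have Vk k : forall s, V k.+1 s <= k%:R * (l / 2) + l / 2 - dl + variation s / l.
  elim: k => [|k IHk] s; first by rewrite mul0r add0r.
  have := value_step_le l0 IHk s; rewrite -(natr1 k) mulrDl mul1r; lra.
apply: le_lt_trans (Vk n (ustart R)) _; rewrite /variation /=.
have -> : n%:R * (l / 2) + l / 2 = r.
  rewrite -[X in _ + X]mul1r -mulrDl natr1 -rr /l; field; rewrite gt_eqF//.
have -> : (2 - 0) / l = r by rewrite /l; field; rewrite gt_eqF.
by rewrite -/r; move: dl0; lra.
Qed.

End continuous_cdf.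

(** * Mean and variance of an optimal policy *)

Lemma expectation_U (d : measure_display) (T : measurableType d) (R : realType)
  (P : probability T R) (m : nat) (X : 'I_m.+1 -> {RV P >-> R})
  (pi : policy T m.+1) (q : nat -> T -> bool) :
  (forall i w, pi i w = q (val i) w) ->
  admissible_policy (@uadm R) (@ustep R) (observation X) m.+1 (ustart R) q ->
  'E_P[U R pi]%E =
    (\int[P]_w (run (@ustep R) (observation X) (ustart R) q m.+1 w).1)%:E.
Proof.
move=> piq qP; rewrite unlock.
under eq_integral do rewrite (U_run X (q := q))//.
apply: integral_EFin_Rintegral; apply: (@bounded_integrable _ _ _ _ _ m.+1%:R).
  apply: measurableT_comp => //.
  by apply: (measurable_run (@measurable_ustep R) qP).
move=> w; have /andP[? ?] :=
  run1_bounds (@ustep R) (observation X) (ustart R) q m.+1 w.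
by rewrite ger0_norm.
Qed.

Theorem theorem2 (d : measure_display) (T : measurableType d) (R : realType)
  (P : probability T R) (n : nat) (X : 'I_n -> {RV P >-> R}) (F : R -> R)
  (n_ge1 : (1 <= n)%N)
  (X_indep : mutually_independent X)
  (F_continuous : continuous F)
  (X_cdf : forall i x, cdf (X i) x = (F x)%:E)
  (pi : policy T n) (pi_optimal : optimal X pi) :
  ('V_P[U R pi] <= 'E_P[U R pi] < (2 * Num.sqrt (n%:R : R))%:E)%E.
Proof.
case: n n_ge1 X X_indep X_cdf pi pi_optimal => [//|m] _ X X_indep X_cdf pi.
move=> [pi_feasible pi_sup].
pose Y := observation X; pose q i := pi (inord i).
have piq i w : pi i w = q (val i) w by rewrite /q inord_val.
have YX (i : 'I_m.+1) : Y i = X i by rewrite /Y /observation inord_val.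
have Y_history := history_independent X_indep YX.
have mA := @measurable_uadm R; have mS := @measurable_ustep R.
have qP := feasible_admissible pi_feasible.
pose b := bellman_policy (@uadm R) (@ustep R) Y m.+1 (ustart R).
pose c := value (@uadm R) (@ustep R) (law Y m.+1) m.+1 (ustart R).
have Eq := expectation_U piq qP.
(* No feasible policy has a mean above [c], and the Bellman policy is feasible with mean [c], so the
   supremum attained by [pi] is [c]. *)
have q_opt : \int[P]_w (run (@ustep R) Y (ustart R) q m.+1 w).1 = c.
  apply/eqP; rewrite eq_le (count_mean_le mA mS Y_history qP) /=.
  rewrite -lee_fin -Eq pi_sup.
  have <- : \int[P]_w (run (@ustep R) Y (ustart R) b m.+1 w).1 = c.
    exact: (bellman_optimal mA mS (ustart R) Y_history).
  apply: ereal_sup_ubound; exists (fun i : 'I_m.+1 => b i).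
    exact: bellman_feasible.
  by apply: expectation_U => //; exact: bellman_admissible.
have {}Eq : 'E_P[U R pi]%E = c%:E by rewrite Eq q_opt.
rewrite Eq lte_fin; apply/andP; split; last first.
  apply: (value_lt F_continuous) => k x.
  by rewrite -(X_cdf (inord (m.+1 - k.+1))).
(* Since [c] is the mean, the variance is the second moment of the count about [c]. *)
rewrite /variance unlock Eq /= unlock.
have -> : (\int[P]_w (((U R pi \- cst c) * (U R pi \- cst c)) w)%:E =
    \int[P]_w (((run (@ustep R) Y (ustart R) q m.+1 w).1 - c) ^+ 2)%:E)%E.
  by apply: eq_integral => w _; rewrite -(U_run X (pi := pi))// expr2.
have mrun := measurable_run mS qP (leqnn m.+1).
rewrite integral_EFin_Rintegral; last first.
  apply: (@bounded_integrable _ _ _ _ _ ((m.+1%:R + `|c|) ^+ 2)).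
    apply: measurable_funX; apply: measurable_funB => //.
    exact: measurableT_comp mrun.
  move=> w; rewrite normrX lerXn2r ?nnegrE ?addr_ge0//.
  apply: le_trans (ler_normB _ _) _; rewrite lerD2r.
  have /andP[? ?] := run1_bounds (@ustep R) Y (ustart R) q m.+1 w.
  by rewrite ger0_norm.
rewrite lee_fin.
exact: (optimal_second_moment mA mS (@le_ustate_sim R) (@ustep_le R)
  Y_history qP).
Qed.
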